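(* Let $A\in\mathbb{R}^{p\times n}$ and $B\in\mathbb{R}^{p\times m}$ satisfy $\operatorname{rge} B\subset \operatorname{rge} A$, let $$\Omega(A,B)=\left\{(Y,W)\in\mathbb{R}^{n\times m}\times\mathbb{S}^n \;\middle|\; AY=B\ \text{ and }\ \tfrac12 YY^T+W\in\mathcal{K}_A^\circ\right\},$$ and let $(Y,W)\in\Omega(A,B)$. Then the normal cone to $\Omega(A,B)$ at $(Y,W)$ is $$N_{\Omega(A,B)}(Y,W)=\left\{(X,V)\in\mathbb{R}^{n\times m}\times\mathbb{S}^n\;\middle|\; V\in\mathcal{K}_A,\ \left\langle V,\tfrac12 YY^T+W\right\rangle=0,\ \text{and } \operatorname{rge}(X-VY)\subset(\ker A)^\perp\right\}.$$
   Context: $\mathbb{S}^n$ is the space of real symmetric $n\times n$ matrices with inner product $\langle V,W\rangle=\mathrm{tr}(VW)$, and $\mathbb{R}^{n\times m}\times\mathbb{S}^n$ carries the inner product $\langle (Y,W),(X,V)\rangle=\mathrm{tr}(Y^TX)+\mathrm{tr}(WV)$. $\operatorname{rge}$ denotes the range (column space). $\mathcal{K}_A:=\{V\in\mathbb{S}^n \mid u^TVu\ge 0\ \text{for all } u\in\ker A\}$ and $\mathcal{K}_A^\circ:=\{W\in\mathbb{S}^n\mid \langle W,V\rangle\le 0\ \text{for all } V\in\mathcal{K}_A\}$ is its polar cone. The set $\Omega(A,B)$ is closed and convex. For a convex set $S$ and $\bar x\in S$, the normal cone is $N_S(\bar x)=\{v\mid \langle v,x-\bar x\rangle\le 0\ \text{for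 all } x\in S\}$. *)

(* Defs.v *)
From mathcomp Require Import all_boot all_order all_algebra.
From mathcomp Require Import boolp classical_sets reals.

Set Implicit Arguments.
Unset Strict Implicit.
Unset Printing Implicit Defensive.

Import Order.TTheory GRing.Theory Num.Theory.
Local Open Scope classical_set_scope.
Local Open Scope ring_scope.

(* Vectors are columns and matrices act by left multiplication, whereas the
   row spaces of mxalgebra (kermx, submx) concern the right action on rows. *)
Definition rge (R : realType) (q k : nat) (M : 'M[R]_(q, k)) : set 'cV[R]_q :=
  [set M *m x | x in [set: 'cV[R]_k]].

Definition ker (R : realType) (q k : nat) (M : 'M[R]_(q, k)) : set 'cV[R]_k :=
  [set u | M *m u = 0].

Definition orth (R : realType) (k : nat) (S : set 'cV[R]_k) : set 'cV[R]_k :=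
  [set v | forall u, S u -> (u^T *m v) 0 0 = 0].

(* S^n is a subset of the n x n matrices; every set of symmetric matrices
   below is cut out of it explicitly. *)
Definition Sym (R : realType) (n : nat) : set 'M[R]_n :=
  [set V | V \is symmetricmx].
Arguments Sym : clear implicits.

Definition ip_sym (R : realType) (n : nat) (V W : 'M[R]_n) : R := \tr (V *m W).

Definition ip_pair (R : realType) (n m : nat)
    (P Q : 'M[R]_(n, m) * 'M[R]_n) : R :=
  \tr (P.1^T *m Q.1) + ip_sym P.2 Q.2.

Definition polar (R : realType) (n : nat) (K : set 'M[R]_n) : set 'M[R]_n :=
  [set W | Sym R n W /\ forall V, K V -> ip_sym W V <= 0].

(* The normal cone in the space of pairs (X, V) with V symmetric. *)
Definition normal_cone (R : realType) (n m : nat)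
    (S : set ('M[R]_(n, m) * 'M[R]_n)) (xbar : 'M[R]_(n, m) * 'M[R]_n) :
    set ('M[R]_(n, m) * 'M[R]_n) :=
  [set v | Sym R n v.2 /\ forall x, S x -> ip_pair v (x - xbar) <= 0].

Definition KA (R : realType) (p n : nat) (A : 'M[R]_(p, n)) : set 'M[R]_n :=
  [set V | Sym R n V /\ forall u, ker A u -> 0 <= (u^T *m V *m u) 0 0].

Definition Omega (R : realType) (p n m : nat)
    (A : 'M[R]_(p, n)) (B : 'M[R]_(p, m)) : set ('M[R]_(n, m) * 'M[R]_n) :=
  [set YW | [/\ Sym R n YW.2,
                A *m YW.1 = B
              & polar (KA A) (2^-1 *: (YW.1 *m YW.1^T) + YW.2)]].

(* Main.v *)
(* Write G(Y, W) = YY^T/2 + W. For V symmetric and D = Y' - Y,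
   <(X, V), (Y', W') - (Y, W)>
     = <X - VY, D> + <V, G(Y', W')> - <V, G(Y, W)> - tr(D^T V D)/2.
   If (Y', W') is in Omega(A, B) then the columns of D lie in ker A, so the three
   conditions on (X, V) make the right-hand side nonpositive. Conversely, moving
   G(Y, W) inside the polar cone with Y fixed forces V in K_A and
   <V, G(Y, W)> = 0, whereas moving Y along t * u z^T with u in ker A and G fixed
   gives t * u^T (X - VY) z <= O(t^2), so that the linear term vanishes. *)
Require Import Defs.
From mathcomp Require Import all_boot all_order all_algebra.
From mathcomp Require Import boolp classical_sets reals.
From mathcomp Require Import ring lra.

Set Implicit Arguments.
Unset Strict Implicit.
Unset Printing Implicit Defensive.

Import Order.TTheory GRing.Theory Num.Theory.
Local Open Scope classical_set_scope.
Local Open Scope ring_scope.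

Lemma Sym_tr (R : realType) (n : nat) (V : 'M[R]_n) : Sym R n V <-> V^T = V.
Proof.
(* [symmetricmx] is a Hermitian condition with sign 1 and the identity as conjugation; both are
   stripped here. *)
rewrite /Sym /= qualifE /= scale1r (map_mx_id (f := idfun)) //.
by split=> [/eqP <-|->].
Qed.

Lemma ip_symC (R : realType) (n : nat) (V W : 'M[R]_n) :
  ip_sym V W = ip_sym W V.
Proof. exact: mxtrace_mulC. Qed.

Lemma ip_symDr (R : realType) (n : nat) (V W1 W2 : 'M[R]_n) :
  ip_sym V (W1 + W2) = ip_sym V W1 + ip_sym V W2.
Proof. by rewrite /ip_sym mulmxDr mxtraceD. Qed.

Lemma ip_symZr (R : realType) (n : nat) (V W : 'M[R]_n) (a : R) :
  ip_sym V (a *: W) = a * ip_sym V W.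
Proof. by rewrite /ip_sym -scalemxAr mxtraceZ. Qed.

Lemma ip_sym_outer (R : realType) (n m : nat) (V : 'M[R]_n) (Y : 'M[R]_(n, m)) :
  ip_sym V (Y *m Y^T) = \tr (Y^T *m V *m Y).
Proof. by rewrite /ip_sym mulmxA mxtrace_mulC mulmxA. Qed.

Lemma mxtrace_outer_mul (R : realType) (n m : nat) (u : 'cV[R]_n)
    (z : 'cV[R]_m) (N : 'M[R]_(n, m)) :
  \tr (N^T *m (u *m z^T)) = (u^T *m (N *m z)) 0 0.
Proof.
by rewrite -mxtrace_tr !trmx_mul !trmxK -mulmxA mxtrace_mulC trace_mx11 -mulmxA.
Qed.

Lemma polarD (R : realType) (n : nat) (K : set 'M[R]_n) (S T : 'M[R]_n) :
  polar K S -> polar K T -> polar K (S + T).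
Proof.
move=> [/Sym_tr symS leS] [/Sym_tr symT leT]; split.
  by apply/Sym_tr; rewrite linearD /= symS symT.
move=> V KV; rewrite ip_symC ip_symDr !(ip_symC V).
by have := leS V KV; have := leT V KV; lra.
Qed.

Lemma polarZ (R : realType) (n : nat) (K : set 'M[R]_n) (a : R) (T : 'M[R]_n) :
  0 <= a -> polar K T -> polar K (a *: T).
Proof.
move=> a_ge0 [/Sym_tr symT leT]; split.
  by apply/Sym_tr; rewrite linearZ /= symT.
by move=> V KV; rewrite ip_symC ip_symZr ip_symC mulr_ge0_le0 ?leT.
Qed.

(** Since <V, uu^T> = u^T V u, these rank-one elements of the polar cone are what later tests
    membership in [KA A]. *)
Lemma polar_KA_outer (R : realType) (p n : nat) (A : 'M[R]_(p, n))
    (u : 'cV[R]_n) : ker A u -> polar (KA A) (- (u *m u^T)).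
Proof.
move=> Au0; split; first by apply/Sym_tr; rewrite linearN /= trmx_mul trmxK.
move=> V [_ /(_ u Au0)]; rewrite -scaleN1r ip_symC ip_symZr ip_sym_outer.
by rewrite trace_mx11 mulN1r oppr_le0.
Qed.

Lemma col_mulmx (R : realType) (p n m : nat) (A : 'M[R]_(p, n))
    (D : 'M[R]_(n, m)) (j : 'I_m) : col j (A *m D) = A *m col j D.
Proof. by rewrite !colE mulmxA. Qed.

Lemma mxtrace_mul_col (R : realType) (n m : nat) (N D : 'M[R]_(n, m)) :
  \tr (N^T *m D) = \sum_j ((col j N)^T *m col j D) 0 0.
Proof. by apply: eq_bigr => j _; rewrite tr_col -col_mulmx -row_mul !mxE. Qed.

Lemma ker_col (R : realType) (p n m : nat) (A : 'M[R]_(p, n))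
    (D : 'M[R]_(n, m)) (j : 'I_m) : A *m D = 0 -> ker A (col j D).
Proof. by move=> AD0; rewrite /ker /= -col_mulmx AD0 col0. Qed.

Lemma KA_mxtrace_ge0 (R : realType) (p n m : nat) (A : 'M[R]_(p, n))
    (V : 'M[R]_n) (D : 'M[R]_(n, m)) :
  KA A V -> A *m D = 0 -> 0 <= \tr (D^T *m V *m D).
Proof.
move=> [_ KV] AD0; rewrite -mulmxA mxtrace_mul_col; apply: sumr_ge0 => j _.
by rewrite col_mulmx mulmxA; apply/KV/ker_col.
Qed.

Lemma mxtrace_orth_ker (R : realType) (p n m : nat) (A : 'M[R]_(p, n))
    (N D : 'M[R]_(n, m)) :
  rge N `<=` orth (ker A) -> A *m D = 0 -> \tr (N^T *m D) = 0.
Proof.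
(* Transposing puts the columns of [D], which lie in the kernel, on the left, as [orth] requires. *)
move=> NA AD0; rewrite -mxtrace_tr trmx_mul trmxK mxtrace_mul_col.
apply: big1 => j _; apply: NA; last exact: ker_col.
by exists (delta_mx j 0); rewrite ?colE.
Qed.

Lemma ip_pair_subE (R : realType) (n m : nat) (X Y Y' : 'M[R]_(n, m))
    (V W W' : 'M[R]_n) : Sym R n V ->
  ip_pair (X, V) ((Y', W') - (Y, W)) =
  \tr ((X - V *m Y)^T *m (Y' - Y)) +
  ip_sym V (2^-1 *: (Y' *m Y'^T) + W') - ip_sym V (2^-1 *: (Y *m Y^T) + W) -
  2^-1 * \tr ((Y' - Y)^T *m V *m (Y' - Y)).
Proof.
move=> /Sym_tr symV; rewrite /ip_pair /= !ip_symDr !ip_symZr !ip_sym_outer.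
rewrite -[- W]scaleN1r ip_symZr !linearB /= trmx_mul symV.
rewrite !(mulmxBl, mulmxBr) !linearB /=.
(* The two mixed terms of the expansion are transposes of each other, hence equal as V is
   symmetric. *)
have -> : \tr (Y'^T *m V *m Y) = \tr (Y^T *m V *m Y').
  by rewrite -mxtrace_tr !trmx_mul trmxK symV mulmxA.
by field.
Qed.

(** Take t = a / k with k > 0 and k > c: the bound becomes a^2 k <= a^2 c, which forces a^2 = 0. *)
Lemma linear_le_quadratic_eq0 (R : realType) (a c : R) :
  (forall t, t * a <= t ^+ 2 * c) -> a = 0.
Proof.
move=> le_ac; set k := `|c| + 1.
have k_gt0 : 0 < k by rewrite ltr_wpDl.
have c_lt_k : c < k by rewrite ltr_pwDr ?ler_norm.
have := le_ac (a / k).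
have -> : a / k * a = a ^+ 2 * k / k ^+ 2 by field; rewrite gt_eqF.
have -> : (a / k) ^+ 2 * c = a ^+ 2 * c / k ^+ 2 by field; rewrite gt_eqF.
rewrite ler_pM2r ?invr_gt0 ?exprn_gt0 // => le_k.
by apply/eqP; rewrite -sqrf_eq0 eq_le sqr_ge0 andbT; nra.
Qed.

Section NormalConeSubset.

Variables (R : realType) (p n m : nat) (A : 'M[R]_(p, n)) (B : 'M[R]_(p, m)).
Variables (X Y : 'M[R]_(n, m)) (V W : 'M[R]_n).
Hypothesis OmegaYW : Omega A B (Y, W).
Hypothesis NXV : normal_cone (Omega A B) (Y, W) (X, V).

Let G := 2^-1 *: (Y *m Y^T) + W.

(** The test point is (Y, W + T): its first component does not move, so only <V, T> survives in
    [ip_pair_subE]. *)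
Lemma normal_cone_polar_le (T : 'M[R]_n) :
  polar (KA A) (G + T) -> ip_sym V T <= 0.
Proof.
move: OmegaYW NXV => [/= /Sym_tr symW AY [/Sym_tr symG _]] [/= symV NV] KT.
have OmegaT : Omega A B (Y, W + T).
  split=> //=; last by rewrite addrA.
  have [/Sym_tr] := KT; rewrite linearD /= symG => /addrI symT _.
  by apply/Sym_tr; rewrite linearD /= symW symT.
have := NV _ OmegaT; rewrite ip_pair_subE // subrr mulmx0 !mxtrace0.
by rewrite mulmx0 mxtrace0 addrA ip_symDr; lra.
Qed.

Lemma normal_cone_quadratic (D : 'M[R]_(n, m)) : A *m D = 0 ->
  \tr ((X - V *m Y)^T *m D) <= 2^-1 * \tr (D^T *m V *m D).
Proof.
move: OmegaYW NXV => [/= /Sym_tr symW AY KG] [/= symV NV] AD0.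
(* This choice compensates the move from Y to Y + D, so that G is unchanged and the two pairings
   with V cancel. *)
pose W' := G - 2^-1 *: ((Y + D) *m (Y + D)^T).
have GE : 2^-1 *: ((Y + D) *m (Y + D)^T) + W' = G by rewrite addrC subrK.
have OmegaD : Omega A B (Y + D, W').
  split=> /=; last by rewrite GE.
    have [/Sym_tr symG _] := KG.
    apply/Sym_tr; rewrite /W' linearB /= symG.
    by rewrite linearZ /= trmx_mul trmxK.
  by rewrite mulmxDr AY AD0 addr0.
have := NV _ OmegaD; rewrite ip_pair_subE // GE -/G [Y + D]addrC !addrK; lra.
Qed.

Lemma normal_cone_KA : KA A V.
Proof.
have [_ _ KG] := OmegaYW; have [symV _] := NXV; split=> // u Au0.
have := normal_cone_polar_le (polarD KG (polar_KA_outer Au0)).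
by rewrite -scaleN1r ip_symZr ip_sym_outer trace_mx11 mulN1r oppr_le0.
Qed.

(** Both 2G and G/2 stay in the polar cone, so T = G and T = - G/2 are admissible and bound <V, G>
    from both sides. *)
Lemma normal_cone_complementary : ip_sym V G = 0.
Proof.
have [_ _ KG] := OmegaYW.
have le0 := normal_cone_polar_le (polarD KG KG).
have KhG : polar (KA A) (G + - 2^-1 *: G).
  have -> : G + - 2^-1 *: G = 2^-1 *: G.
    by rewrite -{1}[G]scale1r -scalerDl; congr (_ *: _); field.
  by apply: polarZ => //; rewrite invr_ge0.
have := normal_cone_polar_le KhG; rewrite ip_symZr => ge0.
by apply/eqP; rewrite eq_le le0; lra.
Qed.

Lemma normal_cone_rge : rge (X - V *m Y) `<=` orth (ker A).
Proof.
move=> _ [z _ <-] u Au0; rewrite -mxtrace_outer_mul.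
set D := u *m z^T; set N := _ - _.
(* The direction t D is feasible for t of either sign because A u = 0; c is the quadratic
   coefficient along D. *)
apply: (linear_le_quadratic_eq0 (c := 2^-1 * \tr (D^T *m V *m D))) => t.
have AtD0 : A *m (t *: D) = 0 by rewrite -scalemxAr mulmxA Au0 mul0mx scaler0.
have := normal_cone_quadratic AtD0.
have -> : (t *: D)^T = t *: D^T by rewrite linearZ.
rewrite -!(scalemxAr, scalemxAl) !mxtraceZ.
by congr (_ <= _); ring.
Qed.

End NormalConeSubset.

Unset Implicit Arguments.

Theorem proposition3p1 (R : realType) (p n m : nat)
    (A : 'M[R]_(p, n)) (B : 'M[R]_(p, m))
    (hAB : rge B `<=` rge A)
    (Y : 'M[R]_(n, m)) (W : 'M[R]_n)
    (hYW : Omega A B (Y, W)) :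
  normal_cone (Omega A B) (Y, W) =
  [set XV : 'M[R]_(n, m) * 'M[R]_n |
     [/\ KA A XV.2,
         ip_sym XV.2 (2^-1 *: (Y *m Y^T) + W) = 0
       & rge (XV.1 - XV.2 *m Y) `<=` orth (ker A)]].
Proof.
apply/seteqP; split=> -[X V] /=.
  move=> NXV; split.
  - exact: normal_cone_KA hYW NXV.
  - exact: normal_cone_complementary hYW NXV.
  - exact: normal_cone_rge hYW NXV.
move=> [KV VG0 rgeN]; have [symV _] := KV; split=> //= -[Y' W'] [/= _ AY' [_ KG']].
have [/= _ AY _] := hYW.
have AD0 : A *m (Y' - Y) = 0 by rewrite mulmxBr AY AY' subrr.
(* What remains is <V, G(Y', W')>, nonpositive by polarity, minus half of a nonnegative trace. *)
rewrite ip_pair_subE // VG0 (mxtrace_orth_ker rgeN AD0).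
have := KA_mxtrace_ge0 KV AD0.
by have := KG' V KV; rewrite ip_symC; lra.
Qed.
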